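(* Both $G$ and ${}_yG_y$ decompose as ascending HNN extensions of $G_y$, and also of ${}_yG$. Both $G_y$ and ${}_yG$ decompose as ascending HNN extensions of $G$, and also of ${}_yG_y$. That is, for each pair $(H,B)$ among $(G,G_y)$, $(G,{}_yG)$, $({}_yG_y,G_y)$, $({}_yG_y,{}_yG)$, $(G_y,G)$, $(G_y,{}_yG_y)$, $({}_yG,G)$, $({}_yG,{}_yG_y)$, there exists an injective endomorphism $\phi\colon B\to B$ such that $H\cong B*_{\phi,t}$.
   Context: **Lodha--Moore groups.** Let $2^{\mathbb{N}}$ be the set of infinite binary sequences and $2^{<\mathbb{N}}$ the set of finite binary sequences, including the empty sequence $\emptyset$. Maps act on the right, so in a product $ab$ one applies first $a$, then $b$. Let $x\colon 2^{\mathbb{N}}\to 2^{\mathbb{N}}$ be the bijection $00\eta\mapsto 0\eta$, $01\eta\mapsto 10\eta$, $1\eta\mapsto 11\eta$. Let $y\colon 2^{\mathbb{N}}\to 2^{\mathbb{N}}$ be the bijection defined, together with its inverse, recursively by $(00\eta).y=0(\eta.y)$, $(01\eta).y=10(\eta.y^{-1})$, $(1\eta).y=11(\eta.y)$ and $(0\eta).y^{-1}=00(\eta.y^{-1})$, $(10\eta).y^{-1}=01(\eta.y)$, $(11\eta).y^{-1}=1(\eta.y^{-1})$. For $s\in 2^{<\mathbb{N}}$ let $x_s$ (resp. $y_s$) be the bijection of $2^{\mathbb{N}}$ sending $s\eta$ to $s(\eta.x)$ (resp. $s(\eta.y)$) and fixing every sequence not having $s$ as a prefix. Let $0^n$, $1^n$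 denote the words of $n$ zeros, resp. $n$ ones, with $0^0=1^0=\emptyset$. Define the following groups of bijections of $2^{\mathbb{N}}$: - ${}_yG_y=\langle x_s,y_t\mid s,t\in 2^{<\mathbb{N}}\rangle$; - $G_y=\langle x_s,y_t\mid s,t\in 2^{<\mathbb{N}},\ t\notin\{0^n\}_{n\ge 0}\rangle$; - ${}_yG=\langle x_s,y_t\mid s,t\in 2^{<\mathbb{N}},\ t\notin\{1^n\}_{n\ge 0}\rangle$; - $G=\langle x_s,y_t\mid s,t\in 2^{<\mathbb{N}},\ t\notin\{0^n,1^n\}_{n\ge 0}\rangle$. **HNN extensions.** For a group $B$ and an injective endomorphism $\phi\colon B\to B$, the ascending HNN extension is $B*_{\phi,t}=\langle B,t\mid t^{-1}bt=\phi(b)\text{ for all }b\in B\rangle$. *)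

(* Defs.v *)
From HB Require Import structures.
From mathcomp Require Import all_boot.
From mathcomp Require Import boolp classical_sets.

Set Implicit Arguments.
Unset Strict Implicit.
Unset Printing Implicit Defensive.

Local Open Scope group_scope.
Local Open Scope quotient_scope.

(* The group of bijections of a type, acting on the right: in a product f * g *)
(* one applies first f, then g. The inverse is stored with the map.           *)

Record bijection (T : Type) := Bijection {
  bij_fun :> T -> T;
  bij_inv : T -> T;
  bij_funK : cancel bij_fun bij_inv;
  bij_invK : cancel bij_inv bij_fun }.

Section BijectionGroup.
Variable T : Type.
Implicit Types f g h : bijection T.

Lemma bijectionP f g : (forall a, f a = g a) -> f = g.
Proof.
case: f g => [f f' fK f'K] [g g' gK g'K] /= fg.
have {fg}efg : f = g by apply: funext.
subst g; have efg' : f' = g' by apply: funext => a; rewrite -{1}(g'K a) fK.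
by subst g'; congr Bijection.
Qed.

Definition bij_one : bijection T :=
  @Bijection T id id (fun=> erefl) (fun=> erefl).

Definition bij_mul f g : bijection T :=
  Bijection (can_comp (bij_funK g) (bij_funK f))
            (can_comp (bij_invK f) (bij_invK g)).

Definition bij_V f : bijection T := Bijection (bij_invK f) (bij_funK f).

HB.instance Definition _ := gen_eqMixin (bijection T).
HB.instance Definition _ := gen_choiceMixin (bijection T).

Fact bij_mulA : associative bij_mul.
Proof. by move=> f g h; apply: bijectionP. Qed.
Fact bij_mul1 : left_id bij_one bij_mul.
Proof. by move=> f; apply: bijectionP. Qed.
Fact bij_mulr1 : right_id bij_one bij_mul.
Proof. by move=> f; apply: bijectionP. Qed.
Fact bij_mulV : left_inverse bij_one bij_V bij_mul.
Proof. by move=> f; apply: bijectionP => a; apply: bij_invK. Qed.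
Fact bij_mulrV : right_inverse bij_one bij_V bij_mul.
Proof. by move=> f; apply: bijectionP => a; apply: bij_funK. Qed.

HB.instance Definition _ := isGroup.Build (bijection T)
  bij_mulA bij_mul1 bij_mulr1 bij_mulV bij_mulrV.

Lemma bijM f g a : (f * g) a = g (f a). Proof. by []. Qed.

End BijectionGroup.

Inductive generates (gT : groupType) (A : set gT) : gT -> Prop :=
| gen_mem g : A g -> generates A g
| gen_1 : generates A 1
| gen_M g h : generates A g -> generates A h -> generates A (g * h)
| gen_V g : generates A g -> generates A g^-1.

Section GeneratedSubgroup.
Variables (gT : groupType) (A : set gT).

Definition generated_pred : {pred gT} := fun g => `[<generates A g>].

Fact generated_closed : group_closed generated_pred.
Proof.
split=> [|g h /asboolP gA /asboolP hA]; apply/asboolP; first exact: gen_1.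
by apply: gen_M gA (gen_V hA).
Qed.

Record generated : Type := Generated {
  gen_val : gT;
  _ : generated_pred gen_val }.

HB.instance Definition _ := [isSub for gen_val].
HB.instance Definition _ := [Choice of generated by <:].
HB.instance Definition _ :=
  SubChoice_isSubGroup.Build gT generated_pred generated generated_closed.

End GeneratedSubgroup.

(* Presentations <X | R>. The letter (x, e) of a word is the generator x if   *)
(* e = true and its inverse if e = false; R u v is the relation u = v.        *)

Definition word (X : Type) := seq (X * bool).

Inductive pres_eq X (R : word X -> word X -> Prop) : word X -> word X -> Prop :=
| pres_refl u : pres_eq R u u
| pres_sym u v : pres_eq R u v -> pres_eq R v u
| pres_trans v u w : pres_eq R u v -> pres_eq R v w -> pres_eq R u w
| pres_cat u u' v v' :
    pres_eq R u u' -> pres_eq R v v' -> pres_eq R (u ++ v) (u' ++ v')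
| pres_cancel x e : pres_eq R [:: (x, e); (x, ~~ e)] [::]
| pres_rel u v : R u v -> pres_eq R u v.

Definition word_inv X (u : word X) : word X :=
  rev [seq (l.1, ~~ l.2) | l <- u].

Section Presentation.
Variables (X : choiceType) (R : word X -> word X -> Prop).

Definition pres_eqb : rel (word X) := fun u v => `[<pres_eq R u v>].

Fact pres_eqb_refl : reflexive pres_eqb.
Proof. by move=> u; apply/asboolP/pres_refl. Qed.
Fact pres_eqb_sym : symmetric pres_eqb.
Proof. by move=> u v; apply/asboolP/asboolP; apply: pres_sym. Qed.
Fact pres_eqb_trans : transitive pres_eqb.
Proof.
by move=> v u w /asboolP uv /asboolP vw; apply/asboolP; apply: pres_trans vw.
Qed.

Canonical pres_equiv := EquivRel pres_eqb pres_eqb_refl pres_eqb_sym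
  pres_eqb_trans.

Definition presented : Type := {eq_quot pres_equiv}.
HB.instance Definition _ := Choice.on presented.
HB.instance Definition _ := EqQuotient.on presented.

Definition pres_class (u : word X) : presented := \pi u.

Lemma pres_classP u v : reflect (pres_eq R u v) (pres_class u == pres_class v).
Proof. by rewrite eqmodE; apply: asboolP. Qed.

Lemma pres_eq_inv u v :
  pres_eq R u v -> pres_eq R (word_inv u) (word_inv v).
Proof.
have catV u1 v1 : word_inv (u1 ++ v1) = word_inv v1 ++ word_inv u1.
  by rewrite /word_inv map_cat rev_cat.
have mulV w : pres_eq R (w ++ word_inv w) [::].
  elim: w => [|[x e] w IHw]; first exact: pres_refl.
  rewrite -cat1s catV -catA [w ++ _]catA.
  have /pres_trans: pres_eq R ([:: (x, e)] ++ (w ++ word_inv w) ++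
      word_inv [:: (x, e)]) ([:: (x, e)] ++ [::] ++ word_inv [:: (x, e)]).
    by apply: pres_cat (pres_refl _ _) (pres_cat IHw (pres_refl _ _)).
  by apply; apply: pres_cancel.
have wK : involutive (@word_inv X).
  move=> w; rewrite /word_inv map_rev revK -map_comp map_id_in // => -[x e] _.
  by rewrite /= negbK.
have Vmul w : pres_eq R (word_inv w ++ w) [::].
  by rewrite -{2}(wK w); apply: mulV.
move=> uv.
apply: (@pres_trans _ _ (word_inv u ++ (v ++ word_inv v))).
  rewrite -[X in pres_eq R X]cats0.
  by apply: pres_cat (pres_refl _ _) (pres_sym (mulV v)).
rewrite catA -[X in pres_eq R _ X]cat0s.
apply: pres_cat (pres_refl _ _).
apply: pres_trans (Vmul u).
by apply: pres_cat (pres_refl _ _) (pres_sym uv).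
Qed.

Definition pres_one : presented := pres_class [::].
Definition pres_mul (p q : presented) : presented :=
  pres_class (repr p ++ repr q).
Definition pres_V (p : presented) : presented := pres_class (word_inv (repr p)).

Lemma pres_reprK (p : presented) : pres_class (repr p) = p.
Proof. exact: reprK. Qed.

Lemma pres_repr_class u : pres_eq R (repr (pres_class u)) u.
Proof. by apply/pres_classP; rewrite pres_reprK. Qed.

Lemma pres_mulE u v :
  pres_mul (pres_class u) (pres_class v) = pres_class (u ++ v).
Proof.
by apply/eqP/pres_classP; apply: pres_cat; apply: pres_repr_class.
Qed.

Lemma pres_VE u : pres_V (pres_class u) = pres_class (word_inv u).
Proof. by apply/eqP/pres_classP/pres_eq_inv/pres_repr_class. Qed.

Fact pres_mulA : associative pres_mul.
Proof.
move=> p q r; rewrite -[p]pres_reprK -[q]pres_reprK -[r]pres_reprK.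
by rewrite !pres_mulE catA.
Qed.
Fact pres_mul1 : left_id pres_one pres_mul.
Proof. by move=> p; rewrite -[p]pres_reprK pres_mulE. Qed.
Fact pres_mulr1 : right_id pres_one pres_mul.
Proof. by move=> p; rewrite -[p]pres_reprK pres_mulE cats0. Qed.
Fact pres_mulrV : right_inverse pres_one pres_V pres_mul.
Proof.
move=> p; rewrite -[p]pres_reprK pres_VE pres_mulE; apply/eqP/pres_classP.
elim: (repr p) => [|[x e] w IHw]; first exact: pres_refl.
have -> : ((x, e) :: w) ++ word_inv ((x, e) :: w) =
    [:: (x, e)] ++ (w ++ word_inv w) ++ [:: (x, ~~ e)].
  by rewrite /word_inv /= rev_cons -cats1 -catA.
apply: pres_trans (pres_cancel R x e).
exact: pres_cat (pres_refl _ _) (pres_cat IHw (pres_refl _ _)).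
Qed.
Fact pres_mulV : left_inverse pres_one pres_V pres_mul.
Proof.
move=> p; have VK : pres_V (pres_V p) = p.
  rewrite -[p]pres_reprK !pres_VE; congr pres_class.
  by rewrite /word_inv map_rev revK -map_comp map_id_in // => -[x e] _ /=;
     rewrite negbK.
by rewrite -{2}VK pres_mulrV.
Qed.

HB.instance Definition _ := isGroup.Build presented
  pres_mulA pres_mul1 pres_mulr1 pres_mulV pres_mulrV.

Lemma pres_classM u v : pres_class (u ++ v) = pres_class u * pres_class v.
Proof. by rewrite -pres_mulE. Qed.

End Presentation.

(* The ascending HNN extension <B, t | t^-1 b t = phi b>: the generators are  *)
(* Some b for b in B and the stable letter t = None; the first family of      *)
(* relations is the multiplication table of B.                                *)

Inductive HNN_rel (B : groupType) (phi : B -> B) :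
    word (option B) -> word (option B) -> Prop :=
| HNN_base b c :
    HNN_rel phi [:: (Some b, true); (Some c, true)] [:: (Some (b * c), true)]
| HNN_stable b :
    HNN_rel phi [:: (None, false); (Some b, true); (None, true)]
                [:: (Some (phi b), true)].

Definition HNN (B : groupType) (phi : {multiplicative B -> B}) : groupType :=
  presented (HNN_rel phi).

Definition isomorphic (G H : groupType) : Prop :=
  exists f : {multiplicative G -> H}, bijective f.

Definition is_ascending_HNN_over (H B : groupType) : Prop :=
  exists phi : {multiplicative B -> B},
    injective phi /\ isomorphic H (HNN phi).

Local Close Scope group_scope.

(* The Cantor set 2^N: the digits 0 and 1 are false and true. *)

Definition cantor := nat -> bool.

Definition scons (b : bool) (a : cantor) : cantor :=
  fun n => if n is m.+1 then a m else b.
Definition scat (s : seq bool) (a : cantor) : cantor := foldr scons a s.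
Definition sdrop (k : nat) (a : cantor) : cantor := fun n => a (k + n).
Definition has_prefix (s : seq bool) (a : cantor) : bool :=
  mkseq a (size s) == s.

Lemma sdrop_scat s a : sdrop (size s) (scat s a) = a.
Proof. by apply: funext => n; elim: s => //= b s <-. Qed.

Lemma has_prefix_scat s a : has_prefix s (scat s a).
Proof.
apply/eqP; elim: s => //= b s IHs; rewrite /mkseq /= (iotaDl 1 0).
by rewrite -map_comp; congr (_ :: _).
Qed.

Lemma has_prefixE s a : has_prefix s a -> a = scat s (sdrop (size s) a).
Proof.
elim: s a => [|b s IHs] a; first by move=> _; apply: funext.
rewrite /has_prefix /mkseq /= (iotaDl 1 0) -map_comp => /eqP[a0 as_].
apply: funext => -[|n] //=.
by rewrite -[LHS]/(sdrop 1 a n) (IHs (sdrop 1 a)) //; apply/eqP.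
Qed.

Definition x_fun (a : cantor) : cantor :=
  match a 0, a 1 with
  | false, false => scat [:: false] (sdrop 2 a)
  | false, true => scat [:: true; false] (sdrop 2 a)
  | true, _ => scat [:: true; true] (sdrop 1 a)
  end.

Definition x_inv (a : cantor) : cantor :=
  match a 0, a 1 with
  | false, _ => scat [:: false; false] (sdrop 1 a)
  | true, false => scat [:: false; true] (sdrop 2 a)
  | true, true => scat [:: true] (sdrop 2 a)
  end.

(* y_digit a n and yV_digit a n are the n-th digits of a.y and a.y^-1. Every  *)
(* clause of the recursive definitions of y and y^-1 outputs one or two       *)
(* digits before recurring, so the recursion is on n; y_funE and yV_funE      *)
(* recover those definitions.                                                 *)

Fixpoint y_digit (a : cantor) (n : nat) {struct n} : bool :=
  match a 0, a 1, n with
  | false, false, 0 => false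
  | false, false, m.+1 => y_digit (sdrop 2 a) m
  | false, true, 0 => true
  | false, true, 1 => false
  | false, true, m.+2 => yV_digit (sdrop 2 a) m
  | true, _, 0 => true
  | true, _, 1 => true
  | true, _, m.+2 => y_digit (sdrop 1 a) m
  end
with yV_digit (a : cantor) (n : nat) {struct n} : bool :=
  match a 0, a 1, n with
  | false, _, 0 => false
  | false, _, 1 => false
  | false, _, m.+2 => yV_digit (sdrop 1 a) m
  | true, false, 0 => false
  | true, false, 1 => true
  | true, false, m.+2 => y_digit (sdrop 2 a) m
  | true, true, 0 => true
  | true, true, m.+1 => yV_digit (sdrop 2 a) m
  end.

Definition y_fun (a : cantor) : cantor := y_digit a.
Definition y_inv (a : cantor) : cantor := yV_digit a.

Lemma y_funE (a : cantor) :
  [/\ y_fun (scat [:: false; false] a) = scat [:: false] (y_fun a),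
      y_fun (scat [:: false; true] a) = scat [:: true; false] (y_inv a) &
      y_fun (scat [:: true] a) = scat [:: true; true] (y_fun a)].
Proof. by split; apply: funext => -[|[|n]]. Qed.

Lemma yV_funE (a : cantor) :
  [/\ y_inv (scat [:: false] a) = scat [:: false; false] (y_inv a),
      y_inv (scat [:: true; false] a) = scat [:: false; true] (y_fun a) &
      y_inv (scat [:: true; true] a) = scat [:: true] (y_inv a)].
Proof. by split; apply: funext => -[|[|n]]. Qed.

Variant cantor_spec_y : cantor -> Type :=
| CantorY00 a : cantor_spec_y (scat [:: false; false] a)
| CantorY01 a : cantor_spec_y (scat [:: false; true] a)
| CantorY1 a : cantor_spec_y (scat [:: true] a).

Lemma cantor_yP a : cantor_spec_y a.
Proof.
case a0: (a 0); first by rewrite (@has_prefixE [:: true] a) ?/has_prefix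
  /mkseq /= ?a0 //; constructor.
case a1: (a 1).
  by rewrite (@has_prefixE [:: false; true] a) ?/has_prefix /mkseq /= ?a0 ?a1
    //; constructor.
by rewrite (@has_prefixE [:: false; false] a) ?/has_prefix /mkseq /= ?a0 ?a1
  //; constructor.
Qed.

Variant cantor_spec_yV : cantor -> Type :=
| CantorYV0 a : cantor_spec_yV (scat [:: false] a)
| CantorYV10 a : cantor_spec_yV (scat [:: true; false] a)
| CantorYV11 a : cantor_spec_yV (scat [:: true; true] a).

Lemma cantor_yVP a : cantor_spec_yV a.
Proof.
case a0: (a 0); last by rewrite (@has_prefixE [:: false] a) ?/has_prefix
  /mkseq /= ?a0 //; constructor.
case a1: (a 1).
  by rewrite (@has_prefixE [:: true; true] a) ?/has_prefix /mkseq /= ?a0 ?a1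
    //; constructor.
by rewrite (@has_prefixE [:: true; false] a) ?/has_prefix /mkseq /= ?a0 ?a1
  //; constructor.
Qed.

Fact x_funK : cancel x_fun x_inv.
Proof. by move=> a; case: (cantor_yP a) => {}a; apply: funext => -[|[|n]]. Qed.
Fact x_invK : cancel x_inv x_fun.
Proof. by move=> a; case: (cantor_yVP a) => {}a; apply: funext => -[|[|n]]. Qed.

Definition x_map : bijection cantor := Bijection x_funK x_invK.

Fact y_cancel n a : y_inv (y_fun a) n = a n /\ y_fun (y_inv a) n = a n.
Proof.
have [k] := ubnP n; elim: k => // k IHk in n a *; rewrite ltnS => le_nk.
have IH b m : m < n -> y_inv (y_fun b) m = b m /\ y_fun (y_inv b) m = b m.
  by move=> lt_mn; apply: IHk; apply: leq_trans lt_mn le_nk.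
split.
  case: (cantor_yP a) => {}a; have [e1 e2 e3] := y_funE a.
  - rewrite e1; have [-> _ _] := yV_funE (y_fun a).
    by case: n {le_nk} IH => [|[|n]] // IH; apply: (IH a n _).1.
  - rewrite e2; have [_ -> _] := yV_funE (y_inv a).
    by case: n {le_nk} IH => [|[|n]] // IH; apply: (IH a n _).2.
  - rewrite e3; have [_ _ ->] := yV_funE (y_fun a).
    by case: n {le_nk} IH => [|n] // IH; apply: (IH a n _).1.
case: (cantor_yVP a) => {}a; have [e1 e2 e3] := yV_funE a.
- rewrite e1; have [-> _ _] := y_funE (y_inv a).
  by case: n {le_nk} IH => [|n] // IH; apply: (IH a n _).2.
- rewrite e2; have [_ -> _] := y_funE (y_fun a).
  by case: n {le_nk} IH => [|[|n]] // IH; apply: (IH a n _).1.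
- rewrite e3; have [_ _ ->] := y_funE (y_inv a).
  by case: n {le_nk} IH => [|[|n]] // IH; apply: (IH a n _).2.
Qed.

Fact y_funK : cancel y_fun y_inv.
Proof. by move=> a; apply: funext => n; apply: (y_cancel n a).1. Qed.
Fact y_invK : cancel y_inv y_fun.
Proof. by move=> a; apply: funext => n; apply: (y_cancel n a).2. Qed.

Definition y_map : bijection cantor := Bijection y_funK y_invK.

Definition at_fun (s : seq bool) (f : cantor -> cantor) (a : cantor) : cantor :=
  if has_prefix s a then scat s (f (sdrop (size s) a)) else a.

Lemma at_fun_scat s f a : at_fun s f (scat s a) = scat s (f a).
Proof. by rewrite /at_fun has_prefix_scat sdrop_scat. Qed.

Lemma at_fun_id s f a : ~~ has_prefix s a -> at_fun s f a = a.
Proof. by rewrite /at_fun => /negPf ->. Qed.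

Fact at_funK s f g : cancel f g -> cancel (at_fun s f) (at_fun s g).
Proof.
move=> fK a; have [/has_prefixE -> | nsa] := boolP (has_prefix s a).
  by rewrite !at_fun_scat fK.
by rewrite !at_fun_id.
Qed.

Definition at_word (s : seq bool) (f : bijection cantor) : bijection cantor :=
  Bijection (at_funK s (bij_funK f)) (at_funK s (bij_invK f)).

Definition x_ (s : seq bool) : bijection cantor := at_word s x_map.
Definition y_ (s : seq bool) : bijection cantor := at_word s y_map.

Definition zeros : set (seq bool) := [set s | exists n, s = nseq n false].
Definition ones : set (seq bool) := [set s | exists n, s = nseq n true].

Definition LM_gens (P : set (seq bool)) : set (bijection cantor) :=
  [set g | (exists s, g = x_ s) \/ (exists t, P t /\ g = y_ t)].

Definition yGy : groupType := generated (LM_gens setT).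
Definition Gy : groupType := generated (LM_gens (~` zeros)).
Definition yG : groupType := generated (LM_gens (~` ones)).
Definition G : groupType := generated (LM_gens (~` (zeros `|` ones))).

(* Main.v *)
From HB Require Import structures.
From mathcomp Require Import all_boot.
From mathcomp Require Import boolp classical_sets.
Require Import Defs.

Set Implicit Arguments.
Unset Strict Implicit.
Unset Printing Implicit Defensive.

Local Open Scope group_scope.
Local Open Scope classical_set_scope.

(** An ascending HNN extension of [B] is recognised inside a group [H] by an
embedding of [B] into [H] and a letter [t] such that conjugation by [t] maps the
image of [B] into itself, the image and [t] generate [H], and no nontrivial
power of [t] lies in the image. Under the relation [b t = t phi(b)] every
element has the form [t^n b t^-m], and such an element is trivial in [H] only
if [b] is a power of [t], hence only if it is already trivial
([HNN_normal_form], [HNN_val_inj], [ascends_HNN]).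

Four of the eight pairs come from the behaviour at [1^oo]. The first two,
[(G, yG)] and [(Gy, yGy)], use a copy of the whole base group inside a cone
([ascends_cone]): [B] acts on the sequences beginning with 1, and [t = x] pushes
that cone to the sequences beginning with 11, since [x] sends [1a] to [11a]. The
copy fixes every sequence beginning with 0 and no nontrivial power of [x] does.
The letter [x] brings back the generators at words beginning with 0, by
conjugation of cones and the relation [x^2 = x_0 x x_1].

The other two, [(yGy, yG)] and [(Gy, G)], use an inclusion ([ascends_y]). Near
[1^oo] an element of [B] adds a constant to the number of leading ones, while
[y] doubles that number; conjugating a translation by a doubling again gives an
integral translation, and no nontrivial power of the doubling is a translation.
So [t = y_1]. That its conjugates really stay in [B] follows from
[y_s = y_{s1} x_s y_{s0} y_{s10}^-1]: iterating at [s = 1, 11, ...] gives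
[y_1 = y_{1^n} b_n] with [b_n] in [B], so an element fixing the cone [1^n]
pointwise has the same conjugate by [y_1] as by [b_n]; the only generator left
is [x], and there [x^{y_1} = x x_1 y_{10} y_{110}^-1].

Exchanging the digits 0 and 1 sends [x_s] and [y_s] to inverses of generators,
exchanges [Gy] and [yG], and fixes [G] and [yGy] ([flip_LM]). It turns these
four decompositions into the other four. *)

(** * Morphisms and subgroups *)

Section Morphisms.
Variables (gT rT : groupType) (f : gT -> rT).
Hypothesis fM : {morph f : g h / g * h}.

Lemma morph_group1 : f 1 = 1.
Proof. by apply: (mulgI (f 1)); rewrite -fM !mulg1. Qed.

Lemma morph_groupV : {morph f : g / g^-1}.
Proof. by move=> g; apply/esym/mulg1_eq; rewrite -fM mulgV morph_group1. Qed.

Lemma morph_groupJ : {morph f : g h / g ^ h}.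
Proof. by move=> g h; rewrite !conjgE !fM morph_groupV. Qed.

Lemma morph_groupX n : {morph f : g / g ^+ n}.
Proof.
by move=> g; elim: n => [|n IHn]; rewrite ?morph_group1 // !expgS fM IHn.
Qed.

End Morphisms.

Definition is_subgroup (gT : groupType) (K : set gT) : Prop :=
  [/\ K 1, forall g h, K g -> K h -> K (g * h) & forall g, K g -> K g^-1].

Lemma generates_subgroup (gT : groupType) (A : set gT) :
  is_subgroup (generates A).
Proof. by split; [exact: gen_1 | exact: gen_M | exact: gen_V]. Qed.

Lemma generates_sub (gT : groupType) (A K : set gT) :
  is_subgroup K -> A `<=` K -> generates A `<=` K.
Proof.
case=> K1 KM KV AK g; elim=> {g} [g /AK||g h _ Kg _ Kh|g _] //.
- exact: KM.
- exact: KV.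
Qed.

Lemma subgroup_conj (gT : groupType) (K : set gT) g h :
  is_subgroup K -> K g -> K h -> K (g ^ h).
Proof. by case=> _ KM KV Kg Kh; apply: KM (KV _ Kh) (KM _ _ Kg Kh). Qed.

Lemma subgroup_preim (gT rT : groupType) (K : set rT) (f : gT -> rT) :
  {morph f : g h / g * h} -> is_subgroup K -> is_subgroup (f @^-1` K).
Proof.
move=> fM [K1 KM KV]; split=> [|g h|g]; rewrite /preimage /=.
- by rewrite (morph_group1 fM).
- by rewrite fM; apply: KM.
- by rewrite (morph_groupV fM); apply: KV.
Qed.

Lemma subgroup_range (gT rT : groupType) (f : gT -> rT) :
  {morph f : g h / g * h} -> is_subgroup (range f).
Proof.
move=> fM; split=> [|_ _ [g _ <-] [h _ <-]|_ [g _ <-]].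
- by exists 1; rewrite ?(morph_group1 fM).
- by exists (g * h); rewrite ?fM.
- by exists g^-1; rewrite ?(morph_groupV fM).
Qed.

Lemma generated_isomorphic (gT K : groupType) (A : set gT) (F : K -> gT) :
    {morph F : p q / p * q} -> injective F -> range F = generates A ->
  isomorphic (generated A) K.
Proof.
move=> FM Finj FA.
have AF (h : generated A) : {p | F p = val h}.
  apply: cid; have /asboolP := valP h; rewrite -FA => -[p _ Fp].
  by exists p.
have FAP p : generated_pred A (F p) by apply/asboolP; rewrite -FA; exists p.
pose u h := projT1 (AF h); have uE h : F (u h) = val h := projT2 (AF h).
have uM : {morph u : g h / g * h}.
  by move=> g h; apply: Finj; rewrite FM !uE.
exists (HB.pack_for {multiplicative generated A -> K} u
  (isMultiplicative.Build _ _ u uM)).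
exists (fun p => Generated (FAP p)) => [h|p]; first by apply: val_inj => /=.
by apply: Finj => /=; rewrite uE.
Qed.

(** * Recognising ascending HNN extensions *)

Section HNNEvaluation.
Variables (B gT : groupType) (phi : {multiplicative B -> B}).
Variables (i : B -> gT) (t : gT).

Definition letter_val (l : option B * bool) : gT :=
  let g := if l.1 is Some b then i b else t in if l.2 then g else g^-1.

Definition word_val (w : word (option B)) : gT :=
  foldr (fun l g => letter_val l * g) 1 w.

Definition HNN_val (p : HNN phi) : gT := word_val (repr p).

Lemma word_val_cat u v : word_val (u ++ v) = word_val u * word_val v.
Proof. by elim: u => [|l u IHu] /=; rewrite ?mul1g // IHu mulgA. Qed.

Hypothesis iM : {morph i : b c / b * c}.
Hypothesis i_phi : forall b, i (phi b) = i b ^ t.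

(** Evaluating words respects the presentation because [t] conjugates the image
of [B] as the stable letter does. *)
Lemma word_val_pres u v : pres_eq (HNN_rel phi) u v -> word_val u = word_val v.
Proof.
elim=> {u v} [//|u v _ //|v u w _ -> //|u u' v v' _ eu _ ev|x e|u v [b c|b]].
- by rewrite !word_val_cat eu ev.
- by case: e; rewrite /word_val /letter_val /= mulg1 ?mulgV ?mulVg.
- by rewrite /word_val /letter_val /= !mulg1 iM.
- by rewrite /word_val /letter_val /= !mulg1 i_phi conjgE.
Qed.

Lemma HNN_val_class w : HNN_val (pres_class (HNN_rel phi) w) = word_val w.
Proof. exact/word_val_pres/pres_repr_class. Qed.

Lemma HNN_valM : {morph HNN_val : p q / p * q}.
Proof.
by move=> p q; rewrite -[p]pres_reprK -[q]pres_reprK -pres_classM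
  !HNN_val_class word_val_cat.
Qed.

Definition HNN_of (b : B) : HNN phi := pres_class _ [:: (Some b, true)].
Definition HNN_t : HNN phi := pres_class _ [:: (None, true)].

Lemma HNN_ofM : {morph HNN_of : b c / b * c}.
Proof.
move=> b c; rewrite -pres_classM; apply/esym/eqP/pres_classP/pres_rel.
exact: HNN_base.
Qed.

Lemma HNN_val_of b : HNN_val (HNN_of b) = i b.
Proof. by rewrite HNN_val_class /word_val /letter_val /= mulg1. Qed.

Lemma HNN_val_t : HNN_val HNN_t = t.
Proof. by rewrite HNN_val_class /word_val /letter_val /= mulg1. Qed.

Lemma pres_class_neg (x : option B) :
  pres_class (HNN_rel phi) [:: (x, false)] = (pres_class _ [:: (x, true)])^-1.
Proof.
apply/esym/mulg1_eq; rewrite -pres_classM; apply/eqP/pres_classP.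
exact: pres_cancel.
Qed.

Lemma HNN_of_phi b : HNN_of (phi b) = HNN_of b ^ HNN_t.
Proof.
have -> : HNN_of b ^ HNN_t = pres_class (HNN_rel phi)
    [:: (None, false); (Some b, true); (None, true)].
  rewrite -cat1s pres_classM (pres_classM _ [:: (Some b, true)]).
  by rewrite conjgE pres_class_neg.
by apply/esym/eqP/pres_classP/pres_rel/HNN_stable.
Qed.

(** Letters of the base move to the right of the stable letter at the cost of
[phi]; this is the only move available, as [phi] need not be onto. *)
Lemma HNN_of_iter n b :
  HNN_of b * HNN_t ^+ n = HNN_t ^+ n * HNN_of (iter n phi b).
Proof.
elim: n => [|n IHn]; first by rewrite expg0 mulg1 mul1g.
by rewrite !expgSr mulgA IHn /= -!mulgA HNN_of_phi -conjgC.
Qed.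

(** Multiplying on the left by a base letter uses [HNN_of_iter]; multiplying by
[t^-1] either cancels a [t] or is moved past the base element, since
[t^-1 b = phi(b) t^-1]. *)
Lemma HNN_normal_form (p : HNN phi) :
  exists n b m, p = HNN_t ^+ n * HNN_of b * HNN_t ^- m.
Proof.
rewrite -[p]pres_reprK; elim: (repr p) => [|[[b|] e] w [n [c [m IHw]]]].
- by exists 0, 1, 0; rewrite (morph_group1 HNN_ofM) expg0 invg1 !mulg1.
- have [c' Ec'] :
      exists c', pres_class (HNN_rel phi) [:: (Some b, e)] = HNN_of c'.
    case: e; [by exists b | exists b^-1].
    by rewrite pres_class_neg (morph_groupV HNN_ofM).
  exists n, (iter n phi c' * c), m.
  by rewrite -cat1s pres_classM IHw Ec' !mulgA HNN_of_iter HNN_ofM !mulgA.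
- rewrite -cat1s pres_classM IHw; case: e.
    by exists n.+1, c, m; rewrite expgS !mulgA.
  rewrite pres_class_neg -/HNN_t; case: n {IHw} => [|n].
    exists 0, (phi c), m.+1; rewrite expg0 !mul1g expgSr invgM mulgA.
    by rewrite HNN_of_phi conjgE mulgA !mulgA mulgK.
  by exists n, c, m; rewrite expgS !mulgA mulVg mul1g.
Qed.

(** An element [t^n b t^-m] evaluating to 1 makes [i b], or its inverse, the
power of [t] of exponent [|m - n|]; so [n = m], and [b = 1]. *)
Lemma HNN_val_inj :
    injective i -> (forall n b, i b = t ^+ n -> n = 0) -> injective HNN_val.
Proof.
move=> i_inj t_out.
suff triv p : HNN_val p = 1 -> p = 1.
  move=> p q eq_pq; apply/divg1_eq/triv.
  by rewrite HNN_valM (morph_groupV HNN_valM) eq_pq mulgV.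
have [n [b [m ->]]] := HNN_normal_form p.
rewrite !HNN_valM HNN_val_of (morph_groupV HNN_valM) !(morph_groupX HNN_valM).
rewrite HNN_val_t => /divg1_eq tb.
have [le_nm|lt_mn] := leqP n m.
  have ib : i b = t ^+ (m - n).
    by apply: (mulgI (t ^+ n)); rewrite tb -expgnDr subnKC.
  have mn0 := t_out _ _ ib; have nm : n = m.
    by apply/eqP; rewrite eqn_leq le_nm -subn_eq0 mn0.
  have -> : b = 1 by apply: i_inj; rewrite ib mn0 expg0 (morph_group1 iM).
  by rewrite (morph_group1 HNN_ofM) mulg1 nm mulgV.
have ib : i b^-1 = t ^+ (n - m).
  rewrite (morph_groupV iM); apply: (mulgI (t ^+ m)).
  by rewrite -expgnDr subnKC 1?ltnW // -tb mulgK.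
by have := t_out _ _ ib; move/eqP; rewrite subn_eq0 leqNgt lt_mn.
Qed.

End HNNEvaluation.

(** The subgroup [S] is an ascending HNN extension of the subgroup [T], embedded
in [S] by [f], with stable letter [t]. Working with subgroups of one ambient
group makes it possible to use both inclusions and self-embeddings of the
ambient group as [f]. *)
Record ascends (gT : groupType) (S T : set gT) (f : gT -> gT) (t : gT) : Prop :=
  Ascends {
    asc_morph : {morph f : g h / g * h};
    asc_inj : injective f;
    asc_base : T `<=` f @^-1` S;
    asc_letter : S t;
    asc_conj : forall b, T b -> exists2 c, T c & f c = f b ^ t;
    asc_gen : forall K, is_subgroup K -> T `<=` f @^-1` K -> K t -> S `<=` K;
    asc_free : forall n b, T b -> f b = t ^+ n -> n = 0 }.

(** The endomorphism [phi] is read off from conjugation by [t]; it is well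
defined and multiplicative because [f] is injective. *)
Theorem ascends_HNN (gT : groupType) (A C : set gT) (f : gT -> gT) (t : gT) :
    ascends (generates A) (generates C) f t ->
  is_ascending_HNN_over (generated A) (generated C).
Proof.
case=> fM f_inj fS tS fJ fgen ffree.
have genP (b : generated C) : generates C (val b).
  by apply/asboolP; exact: (valP b).
pose i (b : generated C) := f (val b).
have iM : {morph i : b c / b * c} by move=> b c; rewrite /i valM fM.
have i_inj : injective i by move=> b c /f_inj/val_inj.
have ex_phi b : {c | i c = i b ^ t}.
  apply: cid; have [c /asboolP Cc fc] := fJ _ (genP b).
  by exists (Generated Cc).
pose phi b := projT1 (ex_phi b).
have iphi b : i (phi b) = i b ^ t := projT2 (ex_phi b).
have phiM : {morph phi : b c / b * c}.
  by move=> b c; apply: i_inj; rewrite iM !iphi iM conjMg.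
pose Phi : {multiplicative generated C -> generated C} :=
  HB.pack_for {multiplicative generated C -> generated C} phi
    (isMultiplicative.Build _ _ phi phiM).
have iPhi b : i (Phi b) = i b ^ t := iphi b.
exists Phi; split.
  by move=> b c; move/(congr1 i); rewrite !iphi => /conjg_inj/i_inj.
have valM := HNN_valM iM iPhi.
apply: (generated_isomorphic valM).
  apply: (HNN_val_inj iM iPhi i_inj) => n b; exact: ffree (genP b).
apply/seteqP; split.
  move=> _ [p _ <-]; rewrite /HNN_val; have [S1 SM SV] := generates_subgroup A.
  elim: (repr p) => // -[[b|] e] w IHw; apply: SM IHw.
    by case: e; [|apply: SV]; apply/fS/genP.
  by case: e; [|apply: SV].
apply: fgen; first exact: subgroup_range.
  move=> b /asboolP Cb; exists (HNN_of Phi (Generated Cb)) => //.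
  by rewrite (HNN_val_of iM iPhi).
by exists (HNN_t Phi) => //; rewrite (HNN_val_t iM iPhi).
Qed.

(** Transport along an automorphism of the ambient group of order two. *)
Lemma ascends_involution (gT : groupType) (S T : set gT) (f s : gT -> gT) t :
    {morph s : g h / g * h} -> involutive s -> ascends S T f t ->
  ascends (s @^-1` S) (s @^-1` T) (s \o f \o s) (s t).
Proof.
move=> sM sK [fM f_inj fS tS fJ fgen ffree].
have s_inj := inv_inj sK.
split=> [g h|||||K Ksub TK tK g Sg|n b Tb] /=.
- by rewrite /= !sM fM sM.
- exact: inj_comp (inj_comp s_inj f_inj) s_inj.
- by move=> b /fS; rewrite /preimage /= sK.
- by rewrite /preimage /= sK.
- move=> b /fJ[c Tc fc]; exists (s c); rewrite /preimage /= sK //.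
  by rewrite fc (morph_groupJ sM).
- rewrite -[g]sK; apply: (fgen (s @^-1` K)) => // [|b Tb].
    exact: subgroup_preim.
  by have := TK (s b); rewrite /preimage /= sK; apply.
- rewrite -(morph_groupX sM) => /s_inj; exact: ffree.
Qed.

(** * Bijections acting on cones *)

Lemma scat_cat s u a : scat (s ++ u) a = scat s (scat u a).
Proof. by rewrite /scat foldr_cat. Qed.

(** Case analysis on whether a sequence lies in the cone of [s], naming the tail
in the first case. *)
Variant prefix_spec s : cantor -> bool -> Type :=
| HasPrefix a : prefix_spec s (scat s a) true
| NoPrefix a : (forall b, a <> scat s b) -> prefix_spec s a false.

Lemma prefixP s a : prefix_spec s a (has_prefix s a).
Proof.
have [/has_prefixE ->|nsa] := boolP (has_prefix s a).
  exact: HasPrefix.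
by apply: NoPrefix => b ab; rewrite ab has_prefix_scat in nsa.
Qed.

Lemma at_word_scat s (g : bijection cantor) a :
  at_word s g (scat s a) = scat s (g a).
Proof. exact: at_fun_scat. Qed.

Lemma at_word_id s (g : bijection cantor) a :
  ~~ has_prefix s a -> at_word s g a = a.
Proof. exact: at_fun_id. Qed.

Lemma at_word_out s (g : bijection cantor) a :
  (forall b, a <> scat s b) -> at_word s g a = a.
Proof.
by move=> na; apply: at_word_id; case: (prefixP s a) na => // b /(_ b).
Qed.

Lemma at_wordM s : {morph at_word s : g h / g * h}.
Proof.
move=> g h; apply: bijectionP => a; rewrite bijM.
case: (prefixP s a) => {}a; first by rewrite !at_word_scat.
by move=> na; rewrite !at_word_out.
Qed.

Lemma scat_inj s : injective (scat s).
Proof. by move=> a b; move/(congr1 (sdrop (size s))); rewrite !sdrop_scat. Qed.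

Lemma at_word_inj s : injective (at_word s).
Proof.
move=> g h gh; apply: bijectionP => a; apply: (@scat_inj s).
by rewrite -!at_word_scat gh.
Qed.

Lemma at_word_cat s u g : at_word s (at_word u g) = at_word (s ++ u) g.
Proof.
apply: bijectionP => a; case: (prefixP s a) => {}a; last first.
  by move=> na; rewrite !at_word_out // => b; rewrite scat_cat; apply: na.
rewrite at_word_scat; case: (prefixP u a) => {}a.
  by rewrite -scat_cat !at_word_scat scat_cat.
by move=> na; rewrite !at_word_out // => b; rewrite scat_cat => /scat_inj/na.
Qed.

Lemma at_word_nil g : at_word [::] g = g.
Proof. by apply: bijectionP => a; apply: (at_word_scat [::]). Qed.

(** Conjugation moves a cone: if [h] sends the cone of [u] onto that of [v]
without touching tails, it carries any action on tails from one to the other.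
With [u = v] this gives the commutation of [h] with every bijection supported on
a cone that [h] fixes pointwise. *)
Lemma at_word_conj u v (g h : bijection cantor) :
  (forall a, h (scat u a) = scat v a) -> at_word u g ^ h = at_word v g.
Proof.
move=> huv; apply: bijectionP => a; rewrite conjgE !bijM.
change (h (at_word u g (bij_inv h a)) = at_word v g a).
case: (prefixP v a) => {}a.
  by rewrite -{1}huv (bij_funK h) !at_word_scat huv.
move=> na; rewrite !at_word_out ?(bij_invK h) // => b.
by move/(congr1 h); rewrite (bij_invK h) huv; apply: na.
Qed.

Lemma at_x_ s u : at_word s (x_ u) = x_ (s ++ u).
Proof. exact: at_word_cat. Qed.

Lemma at_y_ s u : at_word s (y_ u) = y_ (s ++ u).
Proof. exact: at_word_cat. Qed.

(** The pentagon relation of Thompson's group; it expresses [x_{s0}] through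
[x_s] and [x_{s1}], and conversely. *)
Lemma x_square s : x_ s * x_ s = x_ (rcons s false) * x_ s * x_ (rcons s true).
Proof.
rewrite -!cats1 -(at_x_ s [:: false]) -(at_x_ s [:: true]) /x_ -!at_wordM.
congr at_word; apply: bijectionP => a; rewrite !bijM.
have [a0|a1] := boolP (has_prefix [:: false] a); last first.
  rewrite [at_word [:: false] _ a]at_word_id //.
  by case: (cantor_yP a) a1.
rewrite (has_prefixE a0) at_word_scat.
by case: (cantor_yP (sdrop (size [:: false]) a)).
Qed.

(** The recursive definition of [y] as a relation between generators. The usual
form is [y_s = x_s y_{s0} y_{s10}^-1 y_{s11}]; here the factor at [1^oo] is
moved to the front, past [x_s], where it becomes [y_{s1}]. *)
Lemma y_expand s :
  y_ s = y_ (rcons s true) * x_ s * y_ (rcons s false) *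
         (y_ (rcons s true ++ [:: false]))^-1.
Proof.
rewrite -!cats1 -catA -!at_y_ -(morph_groupV (@at_wordM s)) /x_ /y_ -!at_wordM.
congr at_word; apply: bijectionP => a; rewrite !bijM.
case: (cantor_yP a) => {}a; have [y00 y01 y1] := y_funE a.
- by rewrite [LHS]y00.
- by rewrite [LHS]y01.
- by rewrite [LHS]y1.
Qed.

(** * Lodha--Moore groups *)

Definition LM (P : set (seq bool)) : set (bijection cantor) :=
  generates (LM_gens P).

Lemma LM_subgroup P : is_subgroup (LM P).
Proof. exact: generates_subgroup. Qed.

Lemma LM_x P s : LM P (x_ s).
Proof. by apply: gen_mem; left; exists s. Qed.

Lemma LM_y P s : P s -> LM P (y_ s).
Proof. by move=> Ps; apply: gen_mem; right; exists s. Qed.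

Lemma LM_sub P (K : set (bijection cantor)) :
    is_subgroup K -> (forall s, K (x_ s)) -> (forall s, P s -> K (y_ s)) ->
  LM P `<=` K.
Proof.
move=> Ksub Kx Ky; apply: generates_sub => // g.
by case=> [[s ->]|[s [Ps ->]]]; [apply: Kx | apply: Ky].
Qed.

(** * The base group inside a cone *)

Lemma at_word_conj_x00 u g :
  at_word [:: false, false & u] g ^ x_ [::] = at_word (false :: u) g.
Proof. by apply: at_word_conj => a; rewrite /x_ at_word_nil. Qed.

Lemma at_word_conj_x01 u g :
  at_word [:: false, true & u] g ^ x_ [::] = at_word [:: true, false & u] g.
Proof. by apply: at_word_conj => a; rewrite /x_ at_word_nil. Qed.

Lemma at_word_conj_x1 u g :
  at_word (true :: u) g ^ x_ [::] = at_word [:: true, true & u] g.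
Proof. by apply: at_word_conj => a; rewrite /x_ at_word_nil. Qed.

(** Powers of [x^-1] keep lengthening the run of zeros, so that no nontrivial one
fixes [0 1^oo]. *)
Lemma x_moves_zeros n :
  ((x_ [::])^-1 ^+ n) (scat [:: false] (fun=> true)) =
    scat (nseq n.+1 false) (fun=> true).
Proof.
elim: n => [//|n IHn]; rewrite expgSr bijM IHn /x_.
by rewrite -(morph_groupV (@at_wordM [::])) at_word_nil.
Qed.

Lemma scat_zeros_inj m n :
  scat (nseq m false) (fun=> true) = scat (nseq n false) (fun=> true) -> m = n.
Proof.
elim: m n => [|m IHm] [|n] //= E; first by have := congr1 (@^~ 0) E.
- by have := congr1 (@^~ 0) E.
- by congr _.+1; apply/IHm/(@scat_inj [:: false])/E.
Qed.

(** The base group, embedded by prefixing 1 to every word, is pushed into itself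
by [x]. On the set [Q] of words [u] with [1u] in [P], prefixing 1 is allowed, so
that the image of the base group is stable; every word of [P] beginning with 0
is carried by iterating [x] to a word of [P] beginning with
1. The words [0^n], which no such sequence of steps moves away from 0, must be
missing from [P]. *)
Lemma ascends_cone (P Q : set (seq bool)) :
    (forall u, Q u <-> P (true :: u)) -> (forall u, Q u -> Q (true :: u)) ->
    ~ P [::] -> ~ P [:: false] ->
    (forall u, P [:: false, false & u] -> P (false :: u)) ->
    (forall u, P [:: false, true & u] -> P [:: true, false & u]) ->
  ascends (LM P) (LM Q) (at_word [:: true]) (x_ [::]).
Proof.
move=> QP Q1 P0 Pf Pff Pft.
have subP := LM_subgroup P; have subQ := LM_subgroup Q.
split=> [||b Qb||b Qb|K Ksub QK xK|n b _ bx].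
- exact: at_wordM.
- exact: at_word_inj.
- apply: (LM_sub _ _ _ Qb); first exact/subgroup_preim/subP/at_wordM.
    by move=> s; rewrite /preimage /= at_x_; apply: LM_x.
  by move=> s /QP Ps; rewrite /preimage /= at_y_; apply: LM_y.
- exact: LM_x.
- exists (at_word [:: true] b); last by rewrite at_word_cat at_word_conj_x1.
  apply: (LM_sub (K := at_word [:: true] @^-1` LM Q) _ _ _ Qb).
  - exact/subgroup_preim/subQ/at_wordM.
  - by move=> s; rewrite /preimage /= at_x_; apply: LM_x.
  - by move=> s /Q1 Qs; rewrite /preimage /= at_y_; apply: LM_y.
- have [_ KM KV] := Ksub.
  have Kx1 u : K (x_ (true :: u)).
    by rewrite -(at_x_ [:: true]); apply/QK/LM_x.
  have Ky1 u : P (true :: u) -> K (y_ (true :: u)).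
    by move=> /QP Qu; rewrite -(at_y_ [:: true]); apply/QK/LM_y.
  have Kconj g h : g ^ x_ [::] = h -> K h -> K g.
    move=> <- Kgx; rewrite -(conjgK (x_ [::]) g).
    by apply: subgroup_conj (KV _ xK).
  (* On words 0u: x moves 00u to 0u and 01u to 10u, and x_0 comes from the
     pentagon relation. *)
  have K0 u : K (x_ (false :: u)) /\ (P (false :: u) -> K (y_ (false :: u))).
    elim: u => [|[] u [IHx IHy]].
    - split=> // {Pf}.
      have /(canRL (mulgK _))/(canRL (mulgK _)) := esym (x_square [::]).
      move=> ->; apply: (KM _ _ _ (KV _ xK)).
      by apply: (KM _ _ (KM _ _ xK xK)); apply/KV/Kx1.
    - split=> [|/Pft Pu]; apply: (Kconj _ _ (at_word_conj_x01 _ _)).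
        exact: Kx1.
      exact: Ky1.
    - by split=> [|/Pff Pu]; apply: (Kconj _ _ (at_word_conj_x00 _ _)); auto.
  apply: LM_sub => // -[|[] u] //.
  - by case: (K0 u).
  - exact: Ky1.
  - by case: (K0 u).
- have := x_moves_zeros n; rewrite expVgn -bx -(morph_groupV (@at_wordM _)).
  by rewrite at_word_id // => /(@scat_zeros_inj 1)[].
Qed.

(** * The inclusions, with a doubling as stable letter *)

Lemma zerosE s : zeros s = all negb s :> Prop.
Proof.
apply/propext; split=> [[n ->]|]; first by rewrite all_nseq orbT.
by move=> s0; exists (size s); apply/all_pred1P; apply: sub_all s0 => -[].
Qed.

Lemma onesE s : ones s = all id s :> Prop.
Proof.
apply/propext; split=> [[n ->]|]; first by rewrite all_nseq orbT.
by move=> s1; exists (size s); apply/all_pred1P; apply: sub_all s1 => -[].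
Qed.

Lemma at_word_fix_ones u (g : bijection cantor) a :
  ~ ones u -> at_word u g (scat (nseq (size u).+1 true) a) =
    scat (nseq (size u).+1 true) a.
Proof.
move=> u1; rewrite -addn1 nseqD scat_cat at_word_id //.
apply/eqP => Eu; apply: u1; exists (size u).
set b := scat (nseq 1 true) a in Eu.
by have /eqP := has_prefix_scat (nseq (size u) true) b; rewrite size_nseq Eu.
Qed.

Lemma conj_fix_cone s (g : bijection cantor) h :
  (forall a, g (scat s a) = scat s a) -> g ^ at_word s h = g.
Proof.
move=> /(at_word_conj h) hg.
by rewrite conjgE -{2}hg -conjgC mulKg.
Qed.

(** The bijections which, near [1^oo], add a constant to the number of leading
ones and leave the rest of the sequence unchanged. *)
Definition shifts_ones : set (bijection cantor) :=
  [set g | exists p q, forall a,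
     g (scat (nseq p true) a) = scat (nseq q true) a].

Lemma shifts_ones_subgroup : is_subgroup shifts_ones.
Proof.
split=> [|g h [p [q gpq]] [p' [q' hpq]]|g [p [q gpq]]].
- by exists 0, 0.
- exists (p + p'), (q' + q) => a; rewrite bijM nseqD scat_cat gpq.
  by rewrite -scat_cat -nseqD addnC nseqD scat_cat hpq -scat_cat -nseqD.
- exists q, p => a; rewrite -gpq; exact: bij_funK.
Qed.

Lemma shifts_ones_fix u (g : bijection cantor) :
  ~ ones u -> shifts_ones (at_word u g).
Proof.
by move=> u1; exists (size u).+1, (size u).+1 => a; apply: at_word_fix_ones.
Qed.

Lemma LM_shifts_ones P : P `<=` ~` ones -> LM P `<=` shifts_ones.
Proof.
move=> P1; apply: LM_sub => [|s|s /P1]; first exact: shifts_ones_subgroup.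
  have [[n ->]|] := pselect (ones s); last exact: shifts_ones_fix.
  exists n.+1, n.+2 => a; rewrite -(addn2 n) -(addn1 n) !nseqD !scat_cat.
  exact: at_word_scat.
exact: shifts_ones_fix.
Qed.

Definition ones0 n : cantor := scat (nseq n true) (fun=> false).

Lemma ones0_inj : injective ones0.
Proof.
elim=> [|m IHm] [|n] //= E; first by have := congr1 (@^~ 0) E.
- by have := congr1 (@^~ 0) E.
- by congr _.+1; apply/IHm/(@scat_inj [:: true])/E.
Qed.

Lemma y_ones0 n : y_map (ones0 n) = ones0 n.*2.
Proof.
elim: n => [|n IHn].
  have z : scat [:: false; false] (ones0 0) = ones0 0.
    by apply: funext => -[|[|n]].
  have [E _ _] := y_funE (ones0 0); rewrite z in E.
  by apply: funext; elim=> // n IHn; rewrite [y_map _]E.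
have [_ _ E] := y_funE (ones0 n).
by rewrite [LHS]E [y_fun _]IHn.
Qed.

Lemma y1_ones0 m n : (y_ [:: true] ^+ m) (ones0 n.+1) = ones0 (2 ^ m * n).+1.
Proof.
elim: m => [|m IHm]; first by rewrite mul1n.
rewrite expgSr bijM IHm -[ones0 _.+1]/(scat [:: true] (ones0 _)) at_word_scat.
by rewrite y_ones0 -mul2n mulnA -expnS.
Qed.

(** A translation changes lengths of runs of ones at unit speed, the power [m]
of [y_1] at speed [2^m]; comparing two consecutive lengths gives [2^m = 1]. *)
Lemma y1_pow_not_shift m : shifts_ones (y_ [:: true] ^+ m) -> m = 0.
Proof.
case=> p [q ypq].
have E j : (q + j.+1 = (2 ^ m * (p + j)).+1)%N.
  apply: ones0_inj; rewrite /ones0 nseqD scat_cat -ypq -scat_cat -nseqD addnS.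
  exact: y1_ones0.
apply: (@expnI 2) => //; apply: (@addnI (2 ^ m * p)%N).
have -> : (2 ^ m * p + 2 ^ m = 2 ^ m * (p + 1))%N by rewrite mulnDr muln1.
have := E 1%N; rewrite addn2 => -[<-].
by have := E 0%N; rewrite expn0 addn0 !addn1.
Qed.

(** Removing the words [1^n] from [P] removes the doublings at [1^oo], all of
which are recovered from [y_1]. When [P] contains the empty word, expressing
[y] through [y_1] uses [y_0], whence the last hypothesis. *)
Lemma ascends_y (P Q : set (seq bool)) :
    (forall u, Q u <-> P u /\ ~ ones u) ->
    ~` (zeros `|` ones) `<=` P -> P [:: true] -> (P [::] -> P [:: false]) ->
  ascends (LM P) (LM Q) id (y_ [:: true]).
Proof.
move=> QP ncP P1 P0; have subP := LM_subgroup P; have subQ := LM_subgroup Q.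
have [_ QM QV] := subQ.
have Qcons0 n s : Q (true :: nseq n true ++ false :: s).
  have n1 : ~ ones (true :: nseq n true ++ false :: s).
    by rewrite onesE /= all_cat andbF.
  by apply/QP; split=> //; apply: ncP => -[]; rewrite ?zerosE.
(* The factors split off by y_expand sit at words containing a 0. *)
have y1E n : exists2 b, LM Q b & y_ [:: true] = y_ (nseq n.+1 true) * b.
  elim: n => [|n [b Qb ->]].
    by exists 1; [apply: gen_1 | rewrite mulg1].
  rewrite y_expand -!mulgA.
  have -> : rcons (nseq n.+1 true) true = nseq n.+2 true.
    by rewrite -cats1 -(nseqD _ 1) addn1.
  exists (x_ (nseq n.+1 true) * (y_ (rcons (nseq n.+1 true) false) *
    ((y_ (nseq n.+2 true ++ [:: false]))^-1 * b))) => //.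
  apply: (QM); first exact: LM_x.
  apply: (QM).
    by apply: LM_y; rewrite -cats1; apply: Qcons0.
  by apply: QM Qb; apply/QV/LM_y/(Qcons0 n.+1).
(* An element fixing the cone of 1^(|u|+1) commutes with y at that cone, so
   conjugating it by y_1 or by b amounts to the same. *)
have y1fix u (g : bijection cantor) :
    ~ ones u -> LM Q (at_word u g) -> LM Q (at_word u g ^ y_ [:: true]).
  move=> u1 Qg; have [b Qb ->] := y1E (size u).
  rewrite conjgM conj_fix_cone; first exact: subgroup_conj.
  by move=> a; apply: at_word_fix_ones.
(* For n = 0, with y_1 = y_11 b and y_11 = y_1 ^ x, the conjugate of x is x b;
   the pentagon relation then leads from 1^n to 1^(n+1). *)
have y1x n : LM Q (x_ (nseq n true) ^ y_ [:: true]).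
  elim: n => [|n IHn].
    have [b Qb E] := y1E 1%N.
    have -> : x_ [::] ^ y_ [:: true] = x_ [::] * b.
      rewrite conjgE {2}E mulgA -[y_ (nseq 2 true)]at_word_conj_x1.
      by rewrite conjgE !mulgA mulgK mulVg mul1g.
    exact: QM (LM_x _ _) Qb.
  have /(canRL (mulKg _)) := esym (x_square (nseq n true)).
  rewrite -[rcons _ true]cats1 -(nseqD _ 1) addn1 => ->.
  rewrite !conjMg !conjVg; apply: (QM _ _ _ (QM _ _ IHn IHn)).
  apply: QV; rewrite conjMg; apply: QM IHn; apply: y1fix; last exact: LM_x.
  by rewrite onesE all_rcons.
split=> // [||b Qb|K Ksub QK yK|n b Qb bE].
- by apply: LM_sub => // [s|s /QP[Ps _]]; [apply: LM_x | apply: LM_y].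
- exact: LM_y.
- exists (b ^ y_ [:: true]) => //; move: b Qb.
  apply: LM_sub => [|s|s Qs].
  + exact: (subgroup_preim (fun g h => conjMg g h _)).
  + have [[k ->]|s1] := pselect (ones s); first exact: y1x.
    by apply: y1fix => //; apply: LM_x.
  + by have /QP[_ s1] := Qs; apply: y1fix => //; apply: LM_y.
- have [_ KM KV] := Ksub.
  have Ky n : K (y_ (nseq n.+1 true)).
    have [b Qb /esym/(canRL (mulgK _)) ->] := y1E n.
    exact/(KM _ _ yK)/KV/QK.
  apply: LM_sub => // [s|s Ps]; first exact/QK/LM_x.
  have [[[|k] Es]|s1] := pselect (ones s); rewrite ?Es //.
    rewrite y_expand; apply: (KM _ _ (KM _ _ (KM _ _ yK _) _)).
    + exact/QK/LM_x.
    + apply/QK/LM_y/QP; split; first by apply: P0; rewrite Es in Ps.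
      by rewrite onesE.
    + exact/KV/QK/LM_y/(Qcons0 0).
  by apply/QK/LM_y/QP.
- apply: y1_pow_not_shift; rewrite -bE.
  by apply: LM_shifts_ones Qb => u /QP[].
Qed.

(** * Exchanging the digits *)

Definition flip_fun (a : cantor) : cantor := fun n => ~~ a n.

Lemma flip_funK : involutive flip_fun.
Proof. by move=> a; apply: funext => n; apply: negbK. Qed.

Definition flip_map : bijection cantor := Bijection flip_funK flip_funK.

Definition flip (g : bijection cantor) : bijection cantor := g ^ flip_map.

Lemma flipE g a : flip g a = flip_fun (g (flip_fun a)).
Proof. by []. Qed.

Lemma flipM : {morph flip : g h / g * h}.
Proof. by move=> g h; apply: conjMg. Qed.

Lemma flipK : involutive flip.
Proof. by move=> g; apply: bijectionP => a; rewrite !flipE !flip_funK. Qed.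

Lemma flip_scat s a :
  flip_fun (scat s a) = scat (map negb s) (flip_fun a).
Proof. by elim: s => //= b s <-; apply: funext => -[]. Qed.

Lemma flip_at_word s g : flip (at_word s g) = at_word (map negb s) (flip g).
Proof.
apply: bijectionP => a; rewrite flipE -[a]flip_funK.
case: (prefixP s (flip_fun a)) => {}a; rewrite ?flip_funK.
  by rewrite flip_scat !at_word_scat flipE flip_funK flip_scat.
move=> na; rewrite !at_word_out // => b /(congr1 flip_fun).
rewrite flip_funK flip_scat (mapK negbK); exact: na.
Qed.

Lemma flip_x_map : flip x_map = x_map^-1.
Proof.
apply: bijectionP => a; rewrite flipE -[RHS]/(x_inv a).
by case: (cantor_yVP a) => {}a; apply: funext => -[|[|[|n]]] //=; exact: negbK.
Qed.

(** One equation is enough: the clause of [y] which recurs on [y^-1] needs the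
dual equation, and this is the same one at the flipped tail. *)
Lemma y_fun_flip a n : y_fun (flip_fun a) n = ~~ y_inv a n.
Proof.
have [k] := ubnP n; elim: k => // k IHk in n a *; rewrite ltnS => le_nk.
have IH b m : m < n -> y_fun (flip_fun b) m = ~~ y_inv b m.
  by move=> lt_mn; apply: IHk; apply: leq_trans lt_mn le_nk.
case: (cantor_yVP a) => {}a; rewrite flip_scat;
  have [y00 y01 y1] := y_funE (flip_fun a); have [z0 z10 z11] := yV_funE a.
- by rewrite y1 z0; case: n {le_nk} IH => [|[|n]] // IH; apply: IH.
- rewrite y01 z10; case: n {le_nk} IH => [|[|n]] // IH.
  by rewrite /= -[a in RHS]flip_funK IH //= negbK.
- by rewrite y00 z11; case: n {le_nk} IH => [|n] // IH; apply: IH.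
Qed.

Lemma flip_y_map : flip y_map = y_map^-1.
Proof.
apply: bijectionP => a; apply: funext => n; rewrite flipE.
rewrite -[LHS]/(~~ y_fun (flip_fun a) n) y_fun_flip; exact: negbK.
Qed.

(** The generators go to inverses of generators at flipped words. *)
Lemma flip_LM P : flip @^-1` LM P = LM (map negb @^-1` P).
Proof.
have sub R : LM (map negb @^-1` R) `<=` flip @^-1` LM R.
  have subR := LM_subgroup R; have [_ _ RV] := subR.
  apply: LM_sub => [|s|s Rs]; first exact: subgroup_preim flipM subR.
  - rewrite /preimage /= /x_ flip_at_word flip_x_map.
    rewrite (morph_groupV (@at_wordM _)).
    exact/RV/LM_x.
  - rewrite /preimage /= /y_ flip_at_word flip_y_map.
    rewrite (morph_groupV (@at_wordM _)).
    exact/RV/LM_y.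
apply/seteqP; split=> // g Pg; rewrite -[g]flipK; apply: sub.
suff -> : map negb @^-1` (map negb @^-1` P) = P by [].
by apply/predeqP => s; rewrite /preimage /= (mapK negbK).
Qed.

(** Each decomposition at [1^oo] yields its mirror image at [0^oo]. *)
Lemma ascends_LM_HNN P Q P' Q' f t :
    map negb @^-1` P = P' -> map negb @^-1` Q = Q' ->
    ascends (LM P) (LM Q) f t ->
  is_ascending_HNN_over (generated (LM_gens P)) (generated (LM_gens Q)) /\
  is_ascending_HNN_over (generated (LM_gens P')) (generated (LM_gens Q')).
Proof.
move=> <- <- PQ; split; first exact: ascends_HNN PQ.
have := ascends_involution flipM flipK PQ; rewrite !flip_LM.
exact: ascends_HNN.
Qed.

Lemma flip_zeros : map negb @^-1` zeros = ones.
Proof.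
apply/predeqP => s; rewrite /preimage /= zerosE onesE all_map.
by split; apply: sub_all => -[].
Qed.

Lemma flip_ones : map negb @^-1` ones = zeros.
Proof.
apply/predeqP => s; rewrite /preimage /= zerosE onesE all_map.
by split; apply: sub_all => -[].
Qed.

Lemma flip_nonzeros : map negb @^-1` (~` zeros) = ~` ones.
Proof. by rewrite -preimage_setC flip_zeros. Qed.

Lemma flip_nonones : map negb @^-1` (~` ones) = ~` zeros.
Proof. by rewrite -preimage_setC flip_ones. Qed.

Lemma flip_nonconstant :
  map negb @^-1` (~` (zeros `|` ones)) = ~` (zeros `|` ones).
Proof. by rewrite -preimage_setC preimage_setU flip_zeros flip_ones setUC. Qed.

(** * The eight decompositions *)

Theorem mainTheorem1 :
  is_ascending_HNN_over G Gy /\ is_ascending_HNN_over G yG /\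
  is_ascending_HNN_over yGy Gy /\ is_ascending_HNN_over yGy yG /\
  is_ascending_HNN_over Gy G /\ is_ascending_HNN_over Gy yGy /\
  is_ascending_HNN_over yG G /\ is_ascending_HNN_over yG yGy.
Proof.
have [G_yG G_Gy] : is_ascending_HNN_over G yG /\ is_ascending_HNN_over G Gy.
  apply: (ascends_LM_HNN flip_nonconstant flip_nonones).
  apply: ascends_cone => [u|u|||u|u];
    rewrite /setC /setU /= ?zerosE ?onesE //=;
    by [intuition done | move=> []; left].
have [Gy_yGy yG_yGy] :
    is_ascending_HNN_over Gy yGy /\ is_ascending_HNN_over yG yGy.
  apply: (ascends_LM_HNN flip_nonzeros (preimage_setT _)).
  apply: ascends_cone => [u|u|||u|u]; rewrite /setC /= ?zerosE //=;
    by [intuition done | move=> []; left].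
have [yGy_yG yGy_Gy] :
    is_ascending_HNN_over yGy yG /\ is_ascending_HNN_over yGy Gy.
  apply: (ascends_LM_HNN (preimage_setT _) flip_nonones).
  by apply: ascends_y => [u|||] //; split=> // -[].
have [Gy_G yG_G] : is_ascending_HNN_over Gy G /\ is_ascending_HNN_over yG G.
  apply: (ascends_LM_HNN flip_nonzeros flip_nonconstant).
  apply: ascends_y => [u|u||]; rewrite /setC /setU /= ?zerosE ?onesE;
    by [intuition done | move=> []; left].
by do !split.
Qed.
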